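(* There are positive absolute constants $c$ and $c'$ such that $Q(n,\epsilon,5)>c\,\epsilon^{-2}$ whenever $\epsilon>c'(\log n)^{-1/3}$.
   Context: The diameter of a connected graph is the maximum distance between two vertices ($\infty$ if disconnected); the diameter of an edge set $E'$ is the diameter of the graph with edge set $E'$ on the vertices covered by $E'$. $Q(n,\epsilon,d)$ is the minimum $\ell$ such that the edges of any graph on $n$ vertices with minimum degree at least $\epsilon n$ can be covered by $\ell$ edge sets each of diameter at most $d$. Logarithms are base 2. *)

(* Defs.v *)
From HB Require Import structures.
From mathcomp Require Import all_boot all_order all_algebra.
From mathcomp Require Import boolp reals exp.

Set Implicit Arguments.
Unset Strict Implicit.
Unset Printing Implicit Defensive.

Import Order.TTheory GRing.Theory Num.Theory.

Local Open Scope set_scope.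
Local Open Scope ring_scope.

Record sgraph (T : finType) := SGraph {
  adj :> rel T;
  adj_sym : symmetric adj;
  adj_irrefl : irreflexive adj }.

Definition edges (T : finType) (G : sgraph T) : {set {set T}} :=
  [set [set p.1; p.2] | p in [set p : T * T | G p.1 p.2]].

Definition degree (T : finType) (G : sgraph T) (v : T) : nat :=
  #|[set w | G v w]|.

(* Degrees are less than #|T|, so this is the true minimum when T is nonempty. *)
Definition min_degree (T : finType) (G : sgraph T) : nat :=
  \big[minn/#|T|]_(v : T) degree G v.

Definition walk (T : finType) (e : rel T) (x y : T) (k : nat) : bool :=
  [exists p : k.-tuple T, path e x p && (last x p == y)].

Lemma connect_walk (T : finType) (e : rel T) (x y : T) :
  connect e x y -> exists k, walk e x y k.
Proof.
case/connectP=> p pP ->; exists (size p).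
by apply/existsP; exists (in_tuple p); rewrite pP /=.
Qed.

(* The value 0 for disconnected pairs is never used: see [diameter]. *)
Definition dist (T : finType) (e : rel T) (x y : T) : nat :=
  if @idP (connect e x y) is ReflectT xy then ex_minn (connect_walk xy)
  else 0%N.

(* [None] stands for an infinite diameter. *)
Definition diameter (T : finType) (e : rel T) : option nat :=
  if [forall x, forall y, connect e x y]
  then Some (\max_(x : T) \max_(y : T) dist e x y)
  else None.

Definition edge_set_diameter (T : finType) (E : {set {set T}}) : option nat :=
  @diameter {x : T | x \in cover E}
    [rel x y | (val x != val y) && ([set val x; val y] \in E)].

Definition diameter_at_most (T : finType) (E : {set {set T}}) (d : nat) : bool :=
  if edge_set_diameter E is Some k then (k <= d)%N else false.

Definition coverable (T : finType) (G : sgraph T) (d l : nat) : Prop :=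
  exists E : 'I_l -> {set {set T}},
    (forall i, E i \subset edges G /\ diameter_at_most (E i) d) /\
    edges G = \bigcup_i E i.

Definition Q_bound (R : realType) (n : nat) (eps : R) (d l : nat) : Prop :=
  forall G : sgraph 'I_n, eps * n%:R <= (min_degree G)%:R -> coverable G d l.

(* A bound exists whenever d >= 1 (a single edge has diameter 1); the value 0
   is a default for the case where there is none. *)
Definition Q (R : realType) (n : nat) (eps : R) (d : nat) : nat :=
  if pselect (exists l, `[< Q_bound n eps d l >]) is left exl
  then ex_minn exl else 0%N.

Definition log2 (R : realType) (x : R) : R := ln x / ln 2.

(* Main.v *)
Require Import Defs.
From mathcomp Require Import all_boot all_order all_algebra zify ring lra.
From mathcomp Require Import boolp reals exp.

(** Take 2k clusters forming the two sides of a complete bipartite pattern, with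
    k of order 1 / eps, and N = 2^(k^2 + 1) points.  The cluster i contains, for
    each opposite cluster j, a copy of every arc (a, b) of the complete digraph on
    the N points; the copies in i towards j and in j towards i are joined by an
    edge.  Inside a cluster, an arc (a, b) is joined to the (blown-up) affine
    colourings f of F_2^(k^2 + 1) with f a = 1 and f b = 0: this gives every arc
    a constant fraction of the cluster as neighbours, while consecutive arcs
    (a, b) and (b, c) have no common neighbour, as in the shift graph.

    If an edge set of diameter at most 5 contains arcs (u, v), (v, w) of a cluster
    pair (i, j) and arcs (u', v), (v, w') of a pair (i', j'), then the two pairs
    coincide: otherwise some endpoints are at distance at least 6.  So in a cover by r
    sets each set makes each point v a transit point of at most one pair.  If
    2 r <= k^2, some pair has at least N / 2 points that are never transit points,
    and these points are distinguished by the classes in which they are sources of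
    arcs; hence N / 2 <= 2^r, a contradiction.  The order of the graph is
    2^O(k^2), well below the available 2^Omega(k^3). *)

Import Order.TTheory GRing.Theory Num.Theory.

Local Open Scope nat_scope.

(** * Edges, walks and lower bounds on diameters *)

Lemma mem_edges (T : finType) (G : sgraph T) (x y : T) :
  ([set x; y] \in edges G) = G x y.
Proof.
apply/imsetP/idP => [[[u v] /=] | Gxy]; last by exists (x, y); rewrite ?inE.
rewrite inE /= => Guv Exy.
have uxy : u \in [set x; y] by rewrite Exy set21.
have vxy : v \in [set x; y] by rewrite Exy set22.
have uv : u != v by apply: contraTN Guv => /eqP->; rewrite adj_irrefl.
move: uxy vxy uv; rewrite !inE.
by do 2!case/orP=> /eqP ?; subst; rewrite ?eqxx // adj_sym.
Qed.

Lemma diameter_walk {T : finType} {e : rel T} {d k : nat} (x y : T) :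
  diameter e = Some k -> k <= d -> exists2 p, path e x p & last x p = y /\ size p <= d.
Proof.
rewrite /diameter; case: forallP => // conn [<-] le_d.
have : dist e x y <= d.
  apply: leq_trans le_d; apply: leq_trans (leq_bigmax x).
  exact: leq_bigmax y.
rewrite /dist; case: {-}_ / idP => [xy|/negP/negP]; last first.
  by move/forallP: (conn x) => /(_ y) ->.
case: ex_minnP => l /existsP[p /andP[pP /eqP pl]] _ ld.
by exists p => //; split=> //; rewrite size_tuple.
Qed.

Lemma path_lipschitz (T : Type) (e : rel T) (h : T -> nat) (x : T) (p : seq T) :
  (forall u v, e u v -> h v <= (h u).+1) -> path e x p ->
  h (last x p) <= h x + size p.
Proof.
move=> hL; elim: p x => [|y p IHp] x /=; first by rewrite addn0.
case/andP=> exy /IHp le_h; apply: leq_trans le_h _.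
by rewrite addnS -addSn leq_add2r hL.
Qed.

(** Such an [h] certifies that vertices are far apart: each step of a walk inside [E] is an edge of
    [G], so [h] rises by at most 1. *)
Lemma diameter_lipschitz {T : finType} {G : sgraph T} {E : {set {set T}}}
    {d : nat} {h : T -> nat} :
  E \subset edges G -> diameter_at_most E d ->
  (forall u v, G u v -> h v <= (h u).+1) ->
  {in cover E &, forall x y, h y <= h x + d}.
Proof.
move=> sEG; rewrite /diameter_at_most.
case dE: edge_set_diameter => [k|] // le_kd hL x y xE yE.
have [p pP [pl ps]] := diameter_walk (Sub x xE) (Sub y yE) dE le_kd.
have hL' (u v : {x | x \in cover E}) :
    (val u != val v) && ([set val u; val v] \in E) -> h (val v) <= (h (val u)).+1.
  by case/andP=> _ /(subsetP sEG); rewrite mem_edges => /hL.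
have := @path_lipschitz _ _ (h \o val) _ _ hL' pP.
by rewrite pl /= => /leq_trans-> //; rewrite leq_add2l.
Qed.

Lemma leq_min_degree {T : finType} {G : sgraph T} {d : nat} :
  0 < #|T| -> (forall v, d <= degree G v) -> d <= min_degree G.
Proof.
case/card_gt0P=> v0 _ dG; rewrite /min_degree.
elim/big_ind: _ => // [|m n dm dn]; last by rewrite leq_min dm.
exact: leq_trans (dG v0) (max_card _).
Qed.

(** * Blow-ups of a graph to a prescribed order *)

Section Blowup.
(* Vertices of the blow-up are labelled by residues, so that its order can be any n >= #|L|. *)
Variables (L : finType) (B : sgraph L) (n : nat).
Hypotheses (L_gt0 : 0 < #|L|) (le_Ln : #|L| <= n).

Definition blowup_label (v : 'I_n) : L :=
  enum_val (Ordinal (ltn_pmod v L_gt0)).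

Definition blowup_rep (l : L) : 'I_n := widen_ord le_Ln (enum_rank l).

Lemma blowup_repK : cancel blowup_rep blowup_label.
Proof.
move=> l; rewrite /blowup_label -[RHS]enum_rankK; congr enum_val.
by apply: val_inj; rewrite /= modn_small.
Qed.

Definition blowup : sgraph 'I_n.
Proof.
exists (fun u v => B (blowup_label u) (blowup_label v)).
- by move=> u v; rewrite adj_sym.
- by move=> u; rewrite adj_irrefl.
Defined.

Lemma card_blowup_fiber (l : L) :
  n %/ #|L| <= #|[set v | blowup_label v == l]|.
Proof.
have lt_n (q : 'I_(n %/ #|L|)) : q * #|L| + enum_rank l < n.
  apply: leq_trans (leq_divM n #|L|).
  apply: (@leq_trans (q.+1 * #|L|)); last by rewrite leq_mul2r ltn_ord orbT.
  by rewrite mulSn addnC ltn_add2r ltn_ord.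
have inj_f : injective (fun q => Ordinal (lt_n q)).
  by move=> p q [/eqP]; rewrite eqn_add2r eqn_pmul2r // => /eqP /val_inj.
rewrite -[leqLHS]card_ord -(card_imset _ inj_f).
apply/subset_leq_card/subsetP=> _ /imsetP[q _ ->]; rewrite inE.
apply/eqP; rewrite /blowup_label -[RHS]enum_rankK; congr enum_val.
by apply: val_inj; rewrite /= modnMDl modn_small.
Qed.

Lemma degree_blowup (v : 'I_n) :
  degree B (blowup_label v) * (n %/ #|L|) <= degree blowup v.
Proof.
rewrite /degree.
rewrite -[leqRHS]sum1_card.
rewrite (partition_big blowup_label (mem [set l | B (blowup_label v) l])) /=;
  last by move=> w; rewrite !inE.
rewrite -sum_nat_const.
apply: leq_sum => l; rewrite inE => Bl.
apply: leq_trans (card_blowup_fiber l) _; rewrite -sum1_card.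
rewrite [leqLHS](eq_bigl (fun w => (w \in [set w | blowup v w]) && (blowup_label w == l))) // => w.
rewrite !inE /=; case: eqP => [->|]; by rewrite ?Bl ?andbF.
Qed.

End Blowup.

(** * The graph on labels and its distance bounds *)

Section LabelGraph.
Variables k m : nat.
Notation V := {set 'I_m}.

(** Subsets are vectors over F_2: the affine form with linear part [y] and constant term [c] is 1 at
    [a] and 0 at [b]. *)
Definition separates (y : V) (c : bool) (a b : V) : bool :=
  (odd #|a :&: y| (+) c) && ~~ (odd #|b :&: y| (+) c).

(* Label (x, z, s, i, j, a, b): in the cluster (s, i), on side s, it is
   - for x = true, the 2-colouring p |-> odd #|p :&: a| (+) z of the points p
     (j and b are ignored: they only balance the multiplicities);
   - for x = false and z = false, the arc (a, b) attached to cluster (~~ s, j);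
   - for z = true or a = b, a filler vertex joined to all colourings. *)
Definition label : finType := (bool * bool * bool * 'I_k * 'I_k * V * V)%type.

Definition label_adj (l l' : label) : bool :=
  let: (x, z, s, i, j, a, b) := l in
  let: (x', z', s', i', j', a', b') := l' in
  match x, x' with
  | true, false =>
      [&& s == s', i == i' & [|| z', a' == b' | separates a z a' b']]
  | false, true =>
      [&& s == s', i == i' & [|| z, a == b | separates a' z' a b]]
  | false, false =>
      [&& ~~ z, ~~ z', a != b, s != s' & [&& i == j', j == i', a == a' & b == b']]
  | true, true => false
  end.

Definition label_graph : sgraph label.
Proof.
exists label_adj.
- move=> [[[[[[x z] s] i] j] a] b] [[[[[[x' z'] s'] i'] j'] a'] b'] /=.
  case: x x' => [] [] //=; rewrite (eq_sym s) (eq_sym i) //.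
  rewrite (eq_sym j) (eq_sym a a') (eq_sym b b').
  case: (a' =P a) => [->|_]; last by rewrite !andbF.
  case: (b' =P b) => [->|_]; last by rewrite !andbF.
  by rewrite andbCA !andbT [(i' == j) && _]andbC.
- by move=> [[[[[[[] z] s] i] j] a] b] //=; rewrite eqxx !andbF.
Defined.

(* A lower bound on the distance from the arcs (i0, j0) on side s0: it is 6 at the
   arcs (i, j) on side s0 with i != i0 and j != j0. *)
Definition height_star (s0 : bool) (i0 j0 : 'I_k) (l : label) : nat :=
  let: (x, z, s, i, j, a, b) := l in
  if s == s0 then
    if i == i0 then if x then 1 else if j == j0 then 0 else 2
    else if x then 5 else if j == j0 then 4 else 6
  else if x then if i == j0 then 2 else 4
  else (if i == j0 then 1 else 3) + (if j == i0 then 0 else 2).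

Ltac split_eqs :=
  repeat match goal with
  | |- context [?u == ?v] => case: (u =P v) => ?; subst => //=
  end.

Lemma height_star_lipschitz s0 i0 j0 l l' :
  label_adj l l' -> height_star s0 i0 j0 l' <= (height_star s0 i0 j0 l).+1.
Proof.
move: l l' => [[[[[[x z] s] i] j] a] b] [[[[[[x' z'] s'] i'] j'] a'] b'].
case: x x' => [] [] //=.
- case/and3P=> /eqP<- /eqP<- _; by split_eqs.
- case/and3P=> /eqP<- /eqP<- _; by split_eqs.
- case/and5P=> _ _ _ ss' /and4P[/eqP<- /eqP<- _ _].
  by case: s s' s0 ss' => [] [] [] //= _; split_eqs.
Qed.

(* A lower bound on the distance from the arc (a0, b0) in cluster (s0, j0) that is
   attached to (~~ s0, i0): it is 6 at arcs consecutive to (a0, b0) that lie in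
   another cluster of side s0 attached to (~~ s0, i0), because the two mates in
   (~~ s0, i0) have no common colouring. *)
Definition height_fork (s0 : bool) (i0 j0 : 'I_k) (a0 b0 : V) (l : label) : nat :=
  let: (x, z, s, i, j, a, b) := l in
  if s == s0 then
    if i == j0 then if x then 1
      else if [&& ~~ z, j == i0, a == a0 & b == b0] then 0 else 2
    else if x then 5
    else if j == i0 then if ~~ z && (a != b) && ((b0 == a) || (a0 == b)) then 6 else 4
    else 6
  else if i == i0 then
    if x then if separates a z a0 b0 then 2 else 4
    else if j == j0 then if [&& ~~ z, a == a0 & b == b0] then 1 else 3
    else if ~~ z && (a != b) && ((b0 == a) || (a0 == b)) then 5 else 3
  else if x then 4 else if j == j0 then 3 else 5.

Lemma separates_chainN y c a b d : separates y c a b -> ~~ separates y c b d.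
Proof. by rewrite /separates => /andP[_ /negbTE->]. Qed.

Lemma height_fork_lipschitz s0 i0 j0 a0 b0 l l' : a0 != b0 ->
  label_adj l l' ->
  height_fork s0 i0 j0 a0 b0 l' <= (height_fork s0 i0 j0 a0 b0 l).+1.
Proof.
move=> ab0.
(* This rules out the one bad jump, between a colouring of height 2 and a mate of height 5. *)
have sep_conflict y c a b : separates y c a b ->
    (b0 == a) || (a0 == b) -> ~~ separates y c a0 b0.
  move=> Sab /orP[]/eqP->; last exact: separates_chainN Sab.
  by apply: contraL Sab; apply: separates_chainN.
move: l l' => [[[[[[x z] s] i] j] a] b] [[[[[[x' z'] s'] i'] j'] a'] b'].
case: x x' => [] [] //=.
- case/and3P=> /eqP<- /eqP<- adj'.
  case: (s =P s0) => _; first by split_eqs; repeat case: ifP.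
  case: (i =P i0) => _; last by split_eqs.
  case: (j' =P j0) => _; first by repeat case: ifP.
  case: ifP => [/andP[/andP[/negbTE z'0 /negbTE ab'] conf]|_]; last by case: ifP.
  move: adj'; rewrite z'0 ab' /= => /sep_conflict/(_ conf)/negbTE-> //.
- case/and3P=> /eqP<- /eqP<- adj'.
  case: (s =P s0) => _; first by split_eqs; repeat case: ifP.
  case: (i =P i0) => _; last by split_eqs.
  case: (j =P j0) => _.
    case: and3P => [[/negbTE z0 /eqP aa /eqP bb]|_]; last by case: ifP.
    by move: adj'; rewrite z0 aa bb (negbTE ab0) /= => ->.
  by repeat case: ifP.
- case/and5P=> /negbTE-> /negbTE-> ab ss' /and4P[/eqP<- /eqP<- /eqP<- /eqP<-] /=.
  rewrite ab.
  case: s s' s0 ss' => [] [] [] //= _;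
  by case: (j =P i0) => _; case: (i =P j0) => _ //=; do ?case: ifP.
Qed.

End LabelGraph.

(** * Degrees in the graph on labels *)

Lemma card_set_ord m : #|{set 'I_m}| = 2 ^ m.
Proof. by rewrite -cardsT -powersetT card_powerset cardsT card_ord. Qed.

Lemma odd_cardI_toggle m (i : 'I_m) (a y : {set 'I_m}) :
  odd #|a :&: [set x | (x == i) (+) (x \in y)]| = (i \in a) (+) odd #|a :&: y|.
Proof.
have split_i (z : {set 'I_m}) :
    #|a :&: z| = ((i \in a) && (i \in z)) + #|(a :&: z) :\ i|.
  by rewrite (cardsD1 i) inE.
rewrite split_i [in RHS]split_i !inE eqxx.
rewrite (_ : (a :&: _) :\ i = (a :&: y) :\ i); last first.
  by apply/setP=> x; rewrite !inE; case: (x == i).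
by rewrite !oddD !oddb; case: (i \in a); case: (i \in y); case: odd.
Qed.

(** Toggling in [y] a point [i] where [a] and [b] differ flips exactly one of the two parities, so
    it injects the complement into the set. *)
Lemma card_odd_neq m (a b : {set 'I_m}) : a != b ->
  2 ^ m <= #|[set y : {set 'I_m} | odd #|a :&: y| != odd #|b :&: y|]|.*2.
Proof.
move=> /eqP ab.
have [i ai] : exists i, (i \in a) != (i \in b).
  apply/existsP; apply: contra_notT ab => /existsPn ab.
  by apply/setP=> i; move: (ab i); rewrite negbK => /eqP.
pose toggle (y : {set 'I_m}) := [set x | (x == i) (+) (x \in y)].
have toggleK : involutive toggle.
  by move=> y; apply/setP=> x; rewrite !inE addbA addbb.
set D := [set y | _].
have sub : toggle @: (~: D) \subset D.
  apply/subsetP=> _ /imsetP[y yD ->]; move: yD; rewrite !inE negbK => /eqP yD.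
  by rewrite !odd_cardI_toggle yD; move: ai; do 2!case: (i \in _); case: odd.
have := subset_leq_card sub; rewrite card_imset; last exact: inv_inj.
have := cardsC D; rewrite card_set_ord.
by move=> <-; rewrite -addnn leq_add2l.
Qed.

Section Degree.
Variables k m : nat.
Notation N := (2 ^ m).

Lemma card_label : #|label k m| = 8 * (k * k * (N * N)).
Proof. by rewrite !card_prod card_bool card_ord card_set_ord; lia. Qed.

Lemma degree_label (l : label k m) :
  k * (N * N) <= (degree (label_graph k m) l).*2.
Proof.
move: l => [[[[[[x z] s] i] j] a] b].
rewrite /degree.
case: x => /=.
  pose f (t : 'I_k * {set 'I_m} * {set 'I_m}) : label k m :=
    (false, true, s, i, t.1.1, t.1.2, t.2).
  have f_inj : injective f by move=> [[? ?] ?] [[? ?] ?] [-> -> ->].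
  have <- : #|[set f t | t : 'I_k * {set 'I_m} * {set 'I_m}]| = k * (N * N).
    by rewrite card_imset // !card_prod card_ord card_set_ord mulnA.
  rewrite -addnn; apply: leq_trans (leq_addr _ _).
  apply/subset_leq_card/subsetP=> _ /imsetP[t _ ->].
  by rewrite inE /= !eqxx.
case: (boolP (z || (a == b))) => [free | /norP[z0 ab]].
  pose f (t : 'I_k * {set 'I_m} * {set 'I_m}) : label k m :=
    (true, true, s, i, t.1.1, t.1.2, t.2).
  have f_inj : injective f by move=> [[? ?] ?] [[? ?] ?] [-> -> ->].
  have <- : #|[set f t | t : 'I_k * {set 'I_m} * {set 'I_m}]| = k * (N * N).
    by rewrite card_imset // !card_prod card_ord card_set_ord mulnA.
  rewrite -addnn; apply: leq_trans (leq_addr _ _).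
  apply/subset_leq_card/subsetP=> _ /imsetP[t _ ->].
  by rewrite inE /= !eqxx orbA free.
pose D := [set y : {set 'I_m} | odd #|a :&: y| != odd #|b :&: y|].
(* The constant term is forced by giving [a] the value 1; then [b] gets 0 exactly when the parities
   differ. *)
pose f (t : 'I_k * {set 'I_m} * {set 'I_m}) : label k m :=
  (true, ~~ odd #|a :&: t.1.2|, s, i, t.1.1, t.1.2, t.2).
have f_inj : injective f by move=> [[? ?] ?] [[? ?] ?] [_ -> -> ->].
pose A := setX (setX [set: 'I_k] D) [set: {set 'I_m}].
have cA : #|f @: A| = k * #|D| * N.
  by rewrite card_imset // !cardsX !cardsT card_ord card_set_ord.
have ND : N <= #|D|.*2 by exact: card_odd_neq.
apply: (@leq_trans #|f @: A|.*2).
  by rewrite cA -mulnA doubleMr leq_mul2l doubleMl leq_mul2r ND !orbT.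
rewrite leq_double; apply/subset_leq_card/subsetP=> _ /imsetP[[[j' y] b'] tA ->].
move: tA; rewrite !inE /= andbT => yD.
rewrite /= !eqxx (negbTE z0) (negbTE ab) /= /separates.
by move: yD; do 2!case: odd.
Qed.

End Degree.

(** * Lower bound on the number of covering sets *)

Section Cover.
Variables k n : nat.
Let m := (k * k).+1.
Notation V := {set 'I_m}.
Notation L := (label k m).
Hypotheses (k_gt0 : 0 < k) (le_Ln : #|L| <= n).

Let L_gt0 : 0 < #|L|.
Proof. by rewrite card_label !muln_gt0 k_gt0 expn_gt0. Qed.

Let G := blowup L (label_graph k m) n L_gt0.
Let rep := @blowup_rep L n le_Ln.

(** With q = n / #|L| rounded down, n < 2q #|L| = 16 k^2 N^2 q where N = 2^m, while every degree is
    at least k N^2 q / 2. *)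
Lemma min_degree_blowup_label : n <= 32 * k * min_degree G.
Proof.
have n_gt0 : 0 < n by apply: leq_trans le_Ln.
have q_gt0 : 0 < n %/ #|L| by rewrite divn_gt0.
have dG (v : 'I_n) : (k * (2 ^ m * 2 ^ m) * (n %/ #|L|) + 1)./2 <= degree G v.
  apply: leq_trans (degree_blowup _ _ _ _ v).
  have := degree_label k m (blowup_label L n L_gt0 v).
  rewrite -(leq_pmul2r q_gt0); lia.
have {dG} := leq_min_degree _ dG; rewrite card_ord => /(_ n_gt0).
have := divn_eq n #|L|; have := ltn_pmod n L_gt0.
move: q_gt0; rewrite card_label; set q := n %/ _; set r := n %% _.
set d := min_degree _; set M := 2 ^ m * 2 ^ m.
move=> q_gt0 ltr -> led.
have led2 : k * M * q <= d.*2 by lia.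
have : 8 * (k * k * M) <= 8 * (k * k * M) * q by rewrite leq_pmulr.
have : k * (k * M * q) <= k * d.*2 by rewrite leq_mul2l led2 orbT.
lia.
Qed.

Definition arc_edge (i j : 'I_k) (a b : V) : {set 'I_n} :=
  [set rep (false, false, false, i, j, a, b); rep (false, false, true, j, i, a, b)].

Lemma arc_edge_edges i j a b : a != b -> arc_edge i j a b \in edges G.
Proof. by move=> ab; rewrite mem_edges /= !blowup_repK /= ab !eqxx. Qed.

Section OneSet.
Variable E : {set {set 'I_n}}.
Hypotheses (sEG : E \subset edges G) (E5 : diameter_at_most E 5).

Let lipschitz (h : L -> nat) :
  (forall l l', label_graph k m l l' -> h l' <= (h l).+1) ->
  forall l l', rep l \in cover E -> rep l' \in cover E -> h l' <= h l + 5.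
Proof.
move=> hL l l' lE l'E.
pose h' v := h (blowup_label L n L_gt0 v).
have hL' (u v : 'I_n) : G u v -> h' v <= (h' u).+1 by apply: hL.
have := diameter_lipschitz sEG E5 hL' _ _ lE l'E.
by rewrite /h' !blowup_repK.
Qed.

Let arc_cover s i j a b :
  arc_edge i j a b \in E ->
  rep (false, false, s, if s then j else i, if s then i else j, a, b) \in cover E.
Proof.
move=> aE; apply/bigcupP; exists (arc_edge i j a b) => //.
by rewrite !inE; case: s; rewrite eqxx ?orbT.
Qed.

Lemma arcs_share i j i' j' a b a' b' :
  arc_edge i j a b \in E -> arc_edge i' j' a' b' \in E -> (i == i') || (j == j').
Proof.
move=> /(arc_cover false) eE /(arc_cover false) e'E; apply: contraT => /norP[ii jj].
have := lipschitz _ (height_star_lipschitz _ _ false i j) _ _ eE e'E.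
by rewrite /= !eqxx eq_sym (negbTE ii) eq_sym (negbTE jj).
Qed.

Lemma consecutive_arcs_right i j j' a b c : a != b -> b != c ->
  arc_edge i j a b \in E -> arc_edge i j' b c \in E -> j = j'.
Proof.
move=> ab bc /(arc_cover true) eE /(arc_cover true) e'E.
apply/eqP; apply: contraT => jj.
have := lipschitz _ (fun l l' => height_fork_lipschitz _ _ true i j a b l l' ab) _ _ eE e'E.
by rewrite /= !eqxx eq_sym (negbTE jj) bc.
Qed.

Lemma consecutive_arcs_left i i' j a b c : a != b -> b != c ->
  arc_edge i j a b \in E -> arc_edge i' j b c \in E -> i = i'.
Proof.
move=> ab bc /(arc_cover false) eE /(arc_cover false) e'E.
apply/eqP; apply: contraT => jj.
have := lipschitz _ (fun l l' => height_fork_lipschitz _ _ false j i a b l l' ab) _ _ eE e'E.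
by rewrite /= !eqxx eq_sym (negbTE jj) bc.
Qed.

Definition transit (v : V) (p : 'I_k * 'I_k) : bool :=
  [exists u, exists w, [&& u != v, v != w,
    arc_edge p.1 p.2 u v \in E & arc_edge p.1 p.2 v w \in E]].

Lemma transit_uniq v p p' : transit v p -> transit v p' -> p = p'.
Proof.
case: p p' => [i j] [i' j'].
move=> /existsP[u /existsP[w /and4P[/= uv vw uvE vwE]]].
move=> /existsP[u' /existsP[w' /and4P[/= uv' vw' uvE' vwE']]].
(* Once one index agrees, the arc into [v] from one pair and the arc out of [v] from the other are
   consecutive. *)
case/orP: (arcs_share _ _ _ _ _ _ _ _ uvE uvE') => /eqP ?; subst.
  by rewrite (consecutive_arcs_right _ _ _ _ _ _ uv vw' uvE vwE').
by rewrite (consecutive_arcs_left _ _ _ _ _ _ uv vw' uvE vwE').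
Qed.

Lemma sum_transit v : \sum_p transit v p <= 1.
Proof.
case: (pickP (transit v)) => [p vp | no]; last first.
  by rewrite big1 // => p _; rewrite no.
rewrite (bigD1 p) //= vp big1 // => q /eqP qp.
by case vq: transit => //; case: qp; apply: transit_uniq vp.
Qed.

End OneSet.

Lemma cover_lower_bound r : coverable G 5 r -> k * k < r.*2.
Proof.
case=> E [E5 EG]; rewrite ltnNge; apply/negP => le_r.
pose T p := \sum_(t < r) \sum_v transit (E t) v p.
have sumT : \sum_p T p <= r * 2 ^ m.
  rewrite exchange_big /=.
  apply: (@leq_trans (\sum_(t < r) \sum_(v : V) 1)).
    apply: leq_sum => t _; rewrite exchange_big; apply: leq_sum => v _.
    by have [sEG dE] := E5 t; apply: (sum_transit _ sEG dE v).
  by rewrite !sum_nat_const card_ord card_set_ord muln1.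
(* Averaging: otherwise k^2 (2^m + 1) <= 2 r 2^m <= k^2 2^m. *)
have [p Tp] : exists p, (T p).*2 <= 2 ^ m.
  apply/existsP; apply: contraLR sumT => /existsPn Tp; rewrite -ltnNge.
  have : \sum_(p : 'I_k * 'I_k) (2 ^ m).+1 <= \sum_p (T p).*2.
    by apply: leq_sum => p _; rewrite ltnNge.
  rewrite sum_nat_const card_prod card_ord -[X in _ <= X](big_morph double doubleD double0).
  have := leq_mul le_r (leqnn (2 ^ m)); have : 0 < k * k by rewrite muln_gt0 k_gt0.
  lia.
case: p Tp => i j Tij.
pose W := [set v | [forall t, ~~ transit (E t) v (i, j)]].
have leWT : #|~: W| <= T (i, j).
  rewrite /T exchange_big -sum1_card big_mkcond /=; apply: leq_sum => v _.
  rewrite !inE; case: forallPn => //= -[t]; rewrite negbK => vt.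
  by rewrite (bigD1 t) //= vt.
(* A class of E containing an arc (a, b) is in [out a], and not in [out b]
   because b is not a transit vertex. *)
pose out v := [set t | [exists w, (v != w) && (arc_edge i j v w \in E t)]].
have out_inj : {in W &, injective out}.
  move=> a b aW bW eq_out; apply/eqP; apply: contraT => ab.
  have : arc_edge i j a b \in \bigcup_t E t by rewrite -EG arc_edge_edges.
  case/bigcupP=> t _ abt.
  have : t \in out b by rewrite -eq_out inE; apply/existsP; exists b; rewrite ab.
  rewrite inE => /existsP[w /andP[bw bwt]].
  move: bW; rewrite inE => /forallP/(_ t)/negP[].
  by apply/existsP; exists a; apply/existsP; exists w; rewrite ab bw abt.
have leW : #|W| <= 2 ^ r.
  rewrite -(card_in_imset out_inj); apply: leq_trans (max_card _) _.
  by rewrite card_set_ord.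
have := cardsC W; rewrite card_set_ord => sumW.
(* At least half of the points lie in [W]. As m = k^2 + 1, this gives k^2 <= r, against 2 r <=
   k^2. *)
have : 2 ^ m <= 2 ^ r.+1 by rewrite expnS; lia.
rewrite leq_exp2l // /m; have : 0 < k * k by rewrite muln_gt0 k_gt0.
lia.
Qed.
End Cover.

(** * Existence of covers and the size of the construction *)

Lemma diameter_leq {T : finType} {e : rel T} {d : nat} :
  (forall x y, exists2 p, path e x p & last x p = y /\ size p <= d) ->
  exists2 k, diameter e = Some k & k <= d.
Proof.
move=> ed.
have conn x y : connect e x y.
  by have [p pP [pl _]] := ed x y; apply/connectP; exists p.
exists (\max_x \max_y dist e x y).
  rewrite /diameter; case: ifP => // /negP[].
  by apply/forallP=> x; apply/forallP=> y.
apply/bigmax_leqP=> x _; apply/bigmax_leqP=> y _.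
rewrite /dist; case: {-}_ / idP => // xy; case: ex_minnP => l _ min_l.
have [p pP [pl pd]] := ed x y; apply: leq_trans pd; apply: min_l.
by apply/existsP; exists (in_tuple p); rewrite pP /= pl.
Qed.

Lemma min_degree_leq {T : finType} (G : sgraph T) (v : T) :
  min_degree G <= degree G v.
Proof.
rewrite /min_degree; have := mem_index_enum v.
elim: (index_enum T) => // w s IHs; rewrite inE big_cons => /predU1P[<-|/IHs].
  exact: geq_minl.
exact: leq_trans (geq_minr _ _).
Qed.

(** One singleton per edge suffices; subsets that are not edges receive [set0]. Hence [Q] never
    takes its default value when [0 < d]. *)
Lemma coverable_edges {T : finType} {G : sgraph T} {d : nat} : 0 < d ->
  coverable G d #|{set T}|.
Proof.
move=> d_gt0.
exists (fun i => if enum_val i \in edges G then [set enum_val i] else set0).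
split=> [i|]; last first.
  apply/setP=> e; apply/idP/bigcupP => [eG | [i _]].
    by exists (enum_rank e) => //; rewrite enum_rankK eG set11.
  by case: ifP => [eG /set1P->|]; rewrite ?inE.
set e := enum_val i; case: ifP => eG; (split; first by rewrite ?sub0set ?sub1set);
  rewrite /diameter_at_most /edge_set_diameter.
  have [|k -> //] := @diameter_leq {x | x \in cover [set e]} 
    [rel x y | (val x != val y) && ([set val x; val y] \in [set e])] d.
  move=> x y; have [<-|xy] := eqVneq x y; first by exists [::].
  exists [:: y] => //=; rewrite andbT (inj_eq val_inj) xy /= inE eqEcard.
  have in_e (w : {x | x \in cover [set e]}) : val w \in e.
    by case: w => w /=; rewrite /cover big_set1.
  rewrite subUset !sub1set !in_e cards2 (inj_eq val_inj) xy.
  by case/imsetP: eG => -[u v] _ ->; rewrite cards2 /=; case: (u != v).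
have [|k -> //] := @diameter_leq {x | x \in cover (set0 : {set {set T}})} 
  [rel x y | (val x != val y) && ([set val x; val y] \in set0)] d.
by move=> x; exfalso; case: x => x; rewrite /cover big_set0 inE.
Qed.

Lemma Q_boundP (R : realType) (n : nat) (eps : R) (d : nat) : 0 < d ->
  Q_bound n eps d (Q n eps d).
Proof.
move=> d_gt0; rewrite /Q; case: pselect => [exl|[]].
  by case: ex_minnP => l /asboolP.
by exists #|{set 'I_n}|; apply/asboolP=> G _; apply: coverable_edges.
Qed.

Lemma card_label_leq (k : nat) : 0 < k ->
  #|label k (k * k).+1| <= 2 ^ (32 * k) ^ 3.
Proof.
move=> k_gt0; rewrite card_label.
have k2 : k * k <= 2 ^ (k + k) by rewrite expnD leq_mul // ltnW // ltn_expl.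
rewrite -expnD (_ : 8 = 2 ^ 3) //.
apply: leq_trans (leq_mul (leqnn _) (leq_mul k2 (leqnn _))) _.
rewrite -!expnD leq_exp2l // !expnS; nia.
Qed.

(** * Choice of the constants *)

Local Open Scope ring_scope.

Lemma expn_lt_log2 (R : realType) (n M : nat) :
  (0 < n)%N -> M%:R < log2 n%:R :> R -> (2 ^ M < n)%N.
Proof.
move=> n_gt0; rewrite /log2 ltr_pdivlMr ?ln_gt0 ?ltr1n // mulr_natl -lnXn //.
by rewrite ltr_ln ?posrE ?exprn_gt0 ?ltr0n // -natrX ltr_nat.
Qed.

Theorem theorem3p6 (R : realType) :
  exists c c' : R, 0 < c /\ 0 < c' /\
    forall (n : nat) (eps : R),
      (1 < n)%N ->
      (exists G : sgraph 'I_n, eps * n%:R <= (min_degree G)%:R) ->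
      c' * log2 n%:R `^ (- (1 / 3)) < eps ->
      c * eps ^- 2 < (Q n eps 5)%:R.
Proof.
(* With u = 1 / (32 eps), the cover bound gives Q > k^2 / 2 > u^2 / 8 = eps^-2 / 8192. *)
exists (8192^-1), 1; split; first by rewrite invr_gt0 ltr0n.
split=> // n eps n_gt1 [G0 G0eps]; rewrite mul1r.
set x := log2 _; set z := x `^ _ => ze.
have n_gt0 : (0 < n)%N by apply: ltnW.
have x_gt0 : 0 < x by rewrite divr_gt0 ?ln_gt0 ?ltr1n.
have z_gt0 : 0 < z by apply: powR_gt0.
have eps_gt0 : 0 < eps by apply: lt_trans ze.
have z3 : x^-1 = z ^+ 3.
  rewrite -powR_mulrn ?ltW // -powRrM mulNr div1r mulVf ?pnatr_eq0 //.
  by rewrite powR_inv1 // ltW.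
(* For large [eps] the bound is below 1, so it is enough that [G0] has an edge. *)
have [eps_big | eps_small] := ltP (32^-1) eps.
  have Q_gt0 : (0 < Q n eps 5)%N.
    case: posnP => // Q0; have := Q_boundP R n eps 5 isT G0 G0eps.
    rewrite Q0 => -[E [_ EG]].
    have edges0 : edges G0 = set0 by rewrite EG big_ord0.
    have deg0 v : degree G0 v = 0%N.
      apply/eqP; rewrite cards_eq0; apply/eqP/setP=> w.
      by rewrite !inE -mem_edges edges0 inE.
    have : (0 < min_degree G0)%N.
      by rewrite -(ltr_nat R); apply: lt_le_trans G0eps; rewrite mulr_gt0 ?ltr0n.
    by move/leq_trans=> /(_ _ (min_degree_leq _ (Ordinal n_gt0))); rewrite deg0.
  have lt1 : 8192^-1 * eps ^- 2 < 1.
    rewrite -exprVn.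
    have : eps^-1 < 32 by rewrite -[32]invrK ltf_pV2 ?posrE ?invr_gt0 ?ltr0n.
    have : 0 < eps^-1 by rewrite invr_gt0.
    nra.
  by apply: lt_le_trans lt1 _; rewrite ler1n.
set u := (32 * eps)^-1.
have u_ge1 : 1 <= u.
  by rewrite invr_ge1 ?unitfE ?gt_eqF ?mulr_gt0 ?ltr0n //; lra.
have u_ge0 : 0 <= u by lra.
(* The largest [k] for which the minimum degree n / (32 k) is still at least eps n. *)
pose k := Num.truncn u.
have /andP[ku uk] := truncn_itv u_ge0.
have k_gt0 : (0 < k)%N by rewrite truncn_gt0.
have keps : eps * (32 * k)%:R <= 1.
  rewrite natrM mulrCA mulrA -ler_pdivlMl ?mulr_gt0 ?ltr0n // mulr1; exact: ku.
have kx : ((32 * k) ^ 3)%:R < x.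
  rewrite natrX -[x]invrK z3 -[_ ^+ 3]invrK ltf_pV2 ?posrE ?invr_gt0 ?exprn_gt0 ?ltr0n ?muln_gt0 //.
  rewrite -exprVn ltrXn2r ?nnegrE ?invr_ge0 ?ltW //.
  apply: lt_le_trans ze _.
  by rewrite -div1r ler_pdivlMr ?ltr0n ?muln_gt0.
have le_n : (#|label k (k * k).+1| <= n)%N.
  exact: leq_trans (card_label_leq k k_gt0) (ltnW (expn_lt_log2 _ _ _ n_gt0 kx)).
have := min_degree_blowup_label k n k_gt0 le_n.
have := cover_lower_bound k n k_gt0 le_n.
set G := blowup _ _ _ _ => lowG degG.
have := lowG _ (Q_boundP R n eps 5 isT G _).
set q := Q _ _ _ => lt_q.
have {lt_q} : (k * k < q.*2)%N.
  apply: lt_q; rewrite -(ler_nat R) in degG.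
  have := ler_wpM2l (ltW eps_gt0) degG; rewrite natrM mulrA => /le_trans-> //.
  by rewrite ler_piMl.
rewrite -(ltr_nat R) -muln2 !natrM => lt_q.
have -> : 8192^-1 * eps ^- 2 = u ^+ 2 / 8.
  by rewrite /u; field; rewrite gt_eqF.
have : u < 2 * k%:R.
  have : 1 <= k%:R :> R by rewrite ler1n.
  by move: uk; rewrite -natr1; lra.
nra.
Qed.
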